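(* For every positive integer $n$, the function $\Phi'$ is a bijection between well-labelled positive paths of size $n$ and marked labelled binary trees with $n$ leaves.
   Context: A well-labelled path of size $n$ is a pair $(\mathbf{p},\sigma)$ where $\mathbf{p}=p_1\ldots p_{n-1}$ is a word on $\{-1,0,+1\}$ and $\sigma=\sigma_1\ldots\sigma_n$ is a permutation of $[n]=\{1,\ldots,n\}$ such that $p_i=-1$ implies $\sigma_i<\sigma_{i+1}$ and $p_i=1$ implies $\sigma_i>\sigma_{i+1}$. It is Motzkin if $\sum_{i=1}^j p_i\ge 0$ for $j=1,\ldots,n-2$ and $\sum_{i=1}^{n-1}p_i=-1$; it is positive if $\sum_{i=1}^j p_i\ge0$ for all $j=1,\ldots,n-1$. For a set $I$ of $m$ integers, $\lambda_I$ is the order-preserving bijection from $[m]$ to $I$. A labelled binary tree of size $n$ is a rooted tree with $n$ leaves carrying distinct labels in $[n]$, each (unlabelled) internal vertex having exactly two unordered children; a marked labelled binary tree is one in which one vertex (internal or leaf) is marked. For a bijection $\lambda$ and a tree $\tau$, $\lambda(\tau)$ replaces each leaf label $i$ by $\lambda(i)$. The map $\Phi$ from well-labelled Motzkin paths of size $n\ge2$ to labelled binary trees with $n\ge 2$ leaves is defined recursively: (i) the unique Motzkin path of size 2 ($\mathbf{p}=-1$, $\sigma=12$) maps to the unique tree of size 2; (ii) if $n>2$ and $p_1=0$, set $\mathbf{p}'=p_2\ldots p_{n-1}$, $\sigma'_i=\lambda^{-1}_{[n]\setminus\{\sigma_1\}}(\sigma_{i+1})$, and $\Phi(\mathbf{p},\sigma)$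 is a root with one subtree a leaf labelled $\sigma_1$ and the other subtree $\lambda_{[n]\setminus\{\sigma_1\}}(\Phi(\mathbf{p}',\sigma'))$; (iii) if $n>2$ and $p_1=1$, let $k$ be least with $\sum_{i=1}^k p_i=0$, set $I'=\{\sigma_1,\ldots,\sigma_k\}$, $I''=\{\sigma_{k+1},\ldots,\sigma_n\}$, $p'_i=-p_{k-i}$ ($i<k$), $p''_i=p_{k+i}$ ($i<n-k$), $\sigma'_i=\lambda^{-1}_{I'}(\sigma_{k+1-i})$, $\sigma''_i=\lambda^{-1}_{I''}(\sigma_{k+i})$, and $\Phi(\mathbf{p},\sigma)$ is a root with subtrees $\lambda_{I'}(\Phi(\mathbf{p}',\sigma'))$ and $\lambda_{I''}(\Phi(\mathbf{p}'',\sigma''))$. The map $\Phi'$ on well-labelled positive paths is defined recursively: (i) the path of size 1 maps to the marked tree consisting of a single marked leaf; (ii) if $n>1$ and $p_1=0$, with $\mathbf{p}',\sigma'$ as in (ii) above, $\Phi'(\mathbf{p},\sigma)$ is an unmarked root with one subtree an unmarked leaf labelled $\sigma_1$ and the other the marked subtree $\lambda_{[n]\setminus\{\sigma_1\}}(\Phi'(\mathbf{p}',\sigma'))$; (iii) if $n>1$ and $p_1=1$, let $k\le n$ be the greatest integer such that $\sum_{i=1}^{j-1}p_i\ge1$ for all $j=2,\ldots,k-1$ and $\sum_{i=1}^{k-1}p_i=1$, and define $I',I'',\mathbf{p}',\mathbf{p}'',\sigma',\sigma''$ by the same formulas as in (iii) above. If $k=n$, $\Phi'(\mathbf{p},\sigma)$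 is the tree $\Phi(\mathbf{p}',\sigma')$ with its root marked; if $k<n$, $\Phi'(\mathbf{p},\sigma)$ is an unmarked root with the unmarked subtree $\lambda_{I'}(\Phi(\mathbf{p}',\sigma'))$ and the marked subtree $\lambda_{I''}(\Phi'(\mathbf{p}'',\sigma''))$. *)

(* Defs.v *)
From mathcomp Require Import all_boot all_order all_algebra.
Set Implicit Arguments. Unset Strict Implicit. Unset Printing Implicit Defensive.
Import Order.TTheory GRing.Theory Num.Theory.

(* A path of size n is a pair (p, s): p : seq int is the word p_1 ... p_(n-1)
   (entries in {-1,0,+1}), s : seq nat is the permutation s_1 ... s_n of [n]. *)

Definition psum (p : seq int) (j : nat) : int := foldr (fun a b => a + b)%R 0%R (take j p).

Definition well_labelled (n : nat) (p : seq int) (s : seq nat) : Prop :=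
  [/\ size p = n.-1, size s = n, perm_eq s (iota 1 n),
      all (fun a => (a == (-1)%R) || (a == 0%R) || (a == 1%R)) p &
      forall i, i < n.-1 ->
        (nth 0%R p i = (-1)%R -> nth 0 s i < nth 0 s i.+1) /\
        (nth 0%R p i = 1%R -> nth 0 s i > nth 0 s i.+1)].

Definition motzkin_path (n : nat) (p : seq int) (s : seq nat) : Prop :=
  well_labelled n p s /\
  (forall j, 1 <= j <= n - 2 -> (0 <= psum p j)%R) /\ psum p n.-1 = (-1)%R.

Definition positive_path (n : nat) (p : seq int) (s : seq nat) : Prop :=
  well_labelled n p s /\ (forall j, 1 <= j <= n.-1 -> (0 <= psum p j)%R).

(* Plane binary trees whose vertices carry a boolean mark; leaves carry a label.
   Children are unordered: trees are compared up to [tree_iso] (swapping children). *)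
Inductive btree : Type :=
| BLeaf (m : bool) (l : nat)
| BNode (m : bool) (a b : btree).

Fixpoint leaves (t : btree) : seq nat :=
  match t with BLeaf _ l => [:: l] | BNode _ a b => leaves a ++ leaves b end.

Fixpoint nmarks (t : btree) : nat :=
  match t with
  | BLeaf m _ => m
  | BNode m a b => m + nmarks a + nmarks b
  end.

Inductive tree_iso : btree -> btree -> Prop :=
| iso_leaf m l : tree_iso (BLeaf m l) (BLeaf m l)
| iso_node m a b a' b' :
    tree_iso a a' -> tree_iso b b' -> tree_iso (BNode m a b) (BNode m a' b')
| iso_swap m a b a' b' :
    tree_iso a b' -> tree_iso b a' -> tree_iso (BNode m a b) (BNode m a' b').

Definition labelled_tree (n : nat) (t : btree) : Prop :=
  perm_eq (leaves t) (iota 1 n) /\ nmarks t = 0.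

Definition marked_ltree (n : nat) (t : btree) : Prop :=
  perm_eq (leaves t) (iota 1 n) /\ nmarks t = 1.

Fixpoint relabel (f : nat -> nat) (t : btree) : btree :=
  match t with
  | BLeaf m l => BLeaf m (f l)
  | BNode m a b => BNode m (relabel f a) (relabel f b)
  end.

Definition mark_root (t : btree) : btree :=
  match t with BLeaf _ l => BLeaf true l | BNode _ a b => BNode true a b end.

(* lambda_I : [m] -> I order preserving, and its inverse *)
Definition lam (I : seq nat) (i : nat) : nat := nth 0 (sort leq I) i.-1.
Definition laminv (I : seq nat) (x : nat) : nat := (index x (sort leq I)).+1.

Definition first_zero (p : seq int) : nat :=
  (find (fun j => psum p j == 0%R) (iota 1 (size p))).+1.

Fixpoint phi (fuel : nat) (p : seq int) (s : seq nat) : btree :=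
  match fuel with
  | 0 => BLeaf false 0
  | fuel'.+1 =>
    if size s <= 2 then BNode false (BLeaf false 1) (BLeaf false 2) else
    match p with
    | [::] => BLeaf false 0
    | a :: pt =>
      if a == 0%R then
        let I := behead s in
        BNode false (BLeaf false (head 0 s))
              (relabel (lam I) (phi fuel' pt (map (laminv I) I)))
      else if a == 1%R then
        let k := first_zero p in
        let I1 := take k s in let I2 := drop k s in
        let p1 := rev (map (fun x => - x)%R (take k.-1 p)) in
        let s1 := map (laminv I1) (rev (take k s)) in
        let p2 := drop k p in
        let s2 := map (laminv I2) (drop k s) in
        BNode false (relabel (lam I1) (phi fuel' p1 s1))
                    (relabel (lam I2) (phi fuel' p2 s2))
      else BLeaf false 0
    end
  end.

Definition Phi (p : seq int) (s : seq nat) : btree := phi (size s) p s.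

Definition last_one (n : nat) (p : seq int) : nat :=
  foldr maxn 0 [seq k <- iota 2 n.-1 | all (fun j => (1 <= psum p j)%R) (iota 1 (k - 2))
                                       && (psum p k.-1 == 1%R)].

Fixpoint phi' (fuel : nat) (p : seq int) (s : seq nat) : btree :=
  match fuel with
  | 0 => BLeaf true 0
  | fuel'.+1 =>
    if size s <= 1 then BLeaf true (head 0 s) else
    match p with
    | [::] => BLeaf true 0
    | a :: pt =>
      if a == 0%R then
        let I := behead s in
        BNode false (BLeaf false (head 0 s))
              (relabel (lam I) (phi' fuel' pt (map (laminv I) I)))
      else if a == 1%R then
        let k := last_one (size s) p in
        let I1 := take k s in let I2 := drop k s in
        let p1 := rev (map (fun x => - x)%R (take k.-1 p)) in
        let s1 := map (laminv I1) (rev (take k s)) in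
        let p2 := drop k p in
        let s2 := map (laminv I2) (drop k s) in
        if k == size s then mark_root (Phi p1 s1)
        else BNode false (relabel (lam I1) (Phi p1 s1))
                         (relabel (lam I2) (phi' fuel' p2 s2))
      else BLeaf true 0
    end
  end.

Definition Phi' (p : seq int) (s : seq nat) : btree := phi' (size s) p s.

(* Main.v *)
(** Forgetting that labels must fill [1..n] turns [Phi] and [Phi'] into relations
    between paths and trees carrying arbitrary distinct labels, in which no
    relabelling occurs; order-preserving relabellings commute with them.

    A Motzkin word starting with [1] is uniquely [negrev p1 ++ -1 :: p2] with
    [p1], [p2] Motzkin (cut at the first return to 0). Both subtrees then have a
    path with a first label, and the step [-1] in the middle forces the first label
    of [p1] to be the smaller one: this is what orders the two unordered children.
    A positive word starting with [1] is, uniquely, either [negrev p1] with [p1]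
    Motzkin, or [negrev p1 ++ a :: p2] with [p1] Motzkin, [p2] positive and [a = 1]
    or [a = -1]. There the mark tells the children apart, and the sign of [a] is
    dictated by the comparison of the first labels of the two subpaths. *)

Require Import Defs.
From mathcomp Require Import all_boot all_order all_algebra zify.
Set Implicit Arguments. Unset Strict Implicit. Unset Printing Implicit Defensive.
Import Order.TTheory GRing.Theory Num.Theory.

(** * Words and partial sums *)

Lemma psumE p j : psum p j = (\sum_(x <- take j p) x)%R.
Proof. by rewrite /psum; elim: (take j p) => [|a q IH] /=; rewrite ?big_nil ?big_cons ?IH. Qed.

Lemma psum0 p : psum p 0 = 0%R.
Proof. by rewrite /psum take0. Qed.

Lemma psumS p j : j < size p -> psum p j.+1 = (psum p j + nth 0 p j)%R.
Proof. by move=> lt_j; rewrite !psumE (take_nth 0%R) // -cats1 big_cat big_seq1. Qed.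

Lemma psum_cons a p j : psum (a :: p) j.+1 = (a + psum p j)%R.
Proof. by []. Qed.

Lemma psum_catl p q j : j <= size p -> psum (p ++ q) j = psum p j.
Proof. by move=> le_j; rewrite !psumE takel_cat. Qed.

Lemma psum_catr p q j :
  psum (p ++ q) (size p + j) = (psum p (size p) + psum q j)%R.
Proof. by rewrite !psumE takeD take_size_cat // drop_size_cat // take_size big_cat. Qed.

Lemma psum_take p k j : j <= k -> psum (take k p) j = psum p j.
Proof. by move=> le_jk; rewrite !psumE take_takel. Qed.

Lemma psum_drop p k j :
  k <= size p -> psum (drop k p) j = (psum p (k + j) - psum p k)%R.
Proof.
move=> le_k; have := psum_catr (take k p) (drop k p) j.
by rewrite cat_take_drop size_takel // psum_take // => ->; rewrite addrAC subrr add0r.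
Qed.

(** The walk traversed backwards in time: the word passed to the first recursive call in the up-step
    clauses. *)
Definition negrev (p : seq int) : seq int := rev [seq (- x)%R | x <- p].

Lemma size_negrev p : size (negrev p) = size p.
Proof. by rewrite size_rev size_map. Qed.

Lemma negrevK : involutive negrev.
Proof.
by move=> p; rewrite /negrev map_rev revK -map_comp map_id_in // => x _ /=; rewrite opprK.
Qed.

Lemma nth_negrev p i : i < size p -> nth 0%R (negrev p) i = (- nth 0 p (size p - i.+1))%R.
Proof.
move=> lt_i; rewrite nth_rev ?size_map //.
have lt_pi : size p - i.+1 < size p by lia.
by rewrite (nth_map 0%R).
Qed.

(** Read backwards, the walk visits the same heights, now measured from its endpoint. *)
Lemma psum_negrev p j : j <= size p ->
  psum (negrev p) j = (psum p (size p - j) - psum p (size p))%R.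
Proof.
elim: j => [|j IH] le_j; first by rewrite psum0 subn0 subrr.
rewrite psumS ?size_negrev // IH 1?ltnW // nth_negrev //.
have -> : size p - j = (size p - j.+1).+1 by lia.
by rewrite psumS; lia.
Qed.

Definition steps (p : seq int) : bool :=
  all (fun a => (a == (-1)%R) || (a == 0%R) || (a == 1%R)) p.

Lemma steps_nth p i : steps p ->
  [\/ nth 0%R p i = (-1)%R, nth 0%R p i = 0%R | nth 0%R p i = 1%R].
Proof.
move=> /allP st; have [lt_i|ge_i] := ltnP i (size p).
  by have /orP[/orP[]|] := st _ (mem_nth 0%R lt_i) => /eqP->;
     [constructor 1|constructor 2|constructor 3].
by rewrite nth_default //; constructor 2.
Qed.

Lemma steps_negrev p : steps (negrev p) = steps p.
Proof. by rewrite /steps all_rev all_map; apply: eq_all => x /=; lia. Qed.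

Definition motzkin_word (p : seq int) : Prop :=
  [/\ steps p, forall j, j < size p -> (0 <= psum p j)%R & psum p (size p) = (-1)%R].

Definition positive_word (p : seq int) : Prop :=
  steps p /\ forall j, j <= size p -> (0 <= psum p j)%R.

Lemma motzkin_word_size p : motzkin_word p -> 0 < size p.
Proof. by case: p => // -[_ _]; rewrite psum0. Qed.

(** A step lowers the height by at most 1, so a nonnegative walk can only reach -1 from 0. *)
Lemma motzkin_word_last p : motzkin_word p -> psum p (size p).-1 = 0%R.
Proof.
move=> mp; have p0 := motzkin_word_size mp; case: mp => st pos tot.
have := @psumS p (size p).-1; rewrite prednK // leqnn tot => /(_ isT).
by have := pos (size p).-1; case: (steps_nth (size p).-1 st) => ->; lia.
Qed.

(** The endpoint of [p] lies strictly below all earlier heights; seen from it, they are all at least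
    1. *)
Lemma psum_negrev_motzkin p q j : motzkin_word p -> 0 < j <= size p ->
  (1 <= psum (negrev p ++ q) j)%R.
Proof.
move=> [_ pos tot] /andP[j0 le_j].
rewrite psum_catl ?size_negrev // psum_negrev // tot.
by have := pos (size p - j); lia.
Qed.

Lemma psum_negrev_motzkin_size p q : motzkin_word p ->
  psum (negrev p ++ q) (size p) = 1%R.
Proof.
move=> [_ _ tot]; rewrite psum_catl ?size_negrev // psum_negrev // tot subnn.
by rewrite psum0.
Qed.

Lemma psum_negrev_motzkin_cat p a q j : motzkin_word p ->
  psum (negrev p ++ a :: q) (size p + j.+1) = (1 + a + psum q j)%R.
Proof.
move=> mp; have tot := psum_negrev_motzkin_size [::] mp; rewrite cats0 in tot.
by rewrite -[in LHS](size_negrev p) psum_catr size_negrev tot psum_cons addrA.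
Qed.

Lemma motzkin_word_down : motzkin_word [:: (-1)%R].
Proof. by split=> // -[]. Qed.

Lemma motzkin_word_flat p : motzkin_word p -> motzkin_word (0%R :: p).
Proof.
move=> [st pos tot]; split=> //= [[|j]|].
- by rewrite psum0.
- by rewrite ltnS psum_cons add0r; apply: pos.
- by rewrite psum_cons add0r.
Qed.

(** The reversed [p] stays above 0 after its start and ends at 1; the down step returns to 0, where
    [q] takes over. *)
Lemma motzkin_word_node p q : motzkin_word p -> motzkin_word q ->
  motzkin_word (negrev p ++ (-1)%R :: q).
Proof.
move=> mp [st pos tot]; have [stp _ _] := mp; split.
- by rewrite /steps all_cat -/(steps _) steps_negrev stp.
- move=> j; rewrite size_cat size_negrev /= => lt_j.
  have [lt_pj|le_jp] := ltnP (size p) j.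
    have -> : j = size p + (j - (size p).+1).+1 by lia.
    rewrite psum_negrev_motzkin_cat //.
    by have := pos (j - (size p).+1); lia.
  case: j le_jp {lt_j} => [|j] le_j; first by rewrite psum0.
  by apply: le_trans (psum_negrev_motzkin _ mp _).
- by rewrite size_cat size_negrev /= psum_negrev_motzkin_cat // tot.
Qed.

Lemma positive_word_flat p : positive_word p -> positive_word (0%R :: p).
Proof.
move=> [st pos]; split=> //= -[|j] le_j; first by rewrite psum0.
by rewrite psum_cons add0r; apply: pos.
Qed.

Lemma positive_word_negrev p : motzkin_word p -> positive_word (negrev p).
Proof.
move=> mp; have [st _ _] := mp; split; first by rewrite steps_negrev.
case=> [|j] le_j; first by rewrite psum0.
have := @psum_negrev_motzkin p [::] j.+1 mp.
by rewrite cats0 -(size_negrev p); lia.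
Qed.

(** After the middle step the height is 0 or 2, so adding the heights of [q] keeps it
    nonnegative. *)
Lemma positive_word_node p a q : motzkin_word p -> positive_word q ->
  (a == (-1)%R) || (a == 1%R) -> positive_word (negrev p ++ a :: q).
Proof.
move=> mp [st pos] a1; have [stp _ _] := mp; split.
  rewrite /steps all_cat -!/(steps _) steps_negrev stp /= -/(steps _) st andbT.
  by case/orP: a1 => ->; rewrite ?orbT.
move=> j; rewrite size_cat size_negrev /= => lt_j.
have [lt_pj|le_jp] := ltnP (size p) j.
  have -> : j = size p + (j - (size p).+1).+1 by lia.
  rewrite psum_negrev_motzkin_cat //.
  by have := pos (j - (size p).+1); lia.
case: j le_jp {lt_j} => [|j] le_j; first by rewrite psum0.
by apply: le_trans (psum_negrev_motzkin _ mp _).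
Qed.

(** * Locating the cut positions *)

Lemma first_zero_node p q : motzkin_word p ->
  first_zero (negrev p ++ (-1)%R :: q) = (size p).+1.
Proof.
move=> mp; rewrite /first_zero size_cat size_negrev /= iotaD find_cat size_iota.
case: ifP => [/hasP[j]|_].
  rewrite mem_iota => lt_j /eqP Ej.
  have := psum_negrev_motzkin ((-1)%R :: q) mp (j := j).
  by rewrite Ej => /(_ ltac:(lia)).
have := psum_negrev_motzkin_cat (-1)%R q 0 mp; rewrite psum0 addn1 => E1.
by rewrite /= add1n E1 addn0.
Qed.

(** [last_one] is a [maxn] fold over its candidates, so it is identified by a candidate that bounds
    all the others. *)
Lemma foldr_maxn_eq (l : seq nat) k :
  k \in l -> (forall x, x \in l -> x <= k) -> foldr maxn 0 l = k.
Proof.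
move=> kl bd; apply/eqP; rewrite eqn_leq; apply/andP; split.
  elim: l bd {kl} => //= x l IH bd; rewrite geq_max bd ?mem_head //=.
  by apply: IH => y yl; apply: bd; rewrite inE yl orbT.
elim: l kl {bd} => //= x l IH; rewrite inE leq_max => /orP[/eqP->|/IH->].
  by rewrite leqnn.
by rewrite orbT.
Qed.

Lemma last_one_negrev p : motzkin_word p ->
  last_one (size p).+1 (negrev p) = (size p).+1.
Proof.
move=> mp; have p0 := motzkin_word_size mp; apply: foldr_maxn_eq; last first.
  by move=> x; rewrite mem_filter mem_iota; lia.
rewrite mem_filter mem_iota -[negrev p]cats0 /= psum_negrev_motzkin_size // eqxx andbT.
apply/andP; split; last by lia.
by apply/allP=> j; rewrite mem_iota => lt_j; apply: psum_negrev_motzkin => //; lia.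
Qed.

(** Height 1 is reached just before [a]. If [a] is 1, all later heights are at least 2; if [a] is
    -1, height 0 follows at once and disqualifies every later candidate. *)
Lemma last_one_node p a q n : motzkin_word p -> positive_word q ->
  (a == (-1)%R) || (a == 1%R) -> n = (size (negrev p ++ a :: q)).+1 ->
  last_one n (negrev p ++ a :: q) = (size p).+1.
Proof.
move=> mp [_ pos] a1 En; have p0 := motzkin_word_size mp.
rewrite size_cat size_negrev /= in En.
apply: foldr_maxn_eq.
  rewrite mem_filter mem_iota /= psum_negrev_motzkin_size // eqxx andbT.
  apply/andP; split; last by lia.
  by apply/allP=> j; rewrite mem_iota => lt_j; apply: psum_negrev_motzkin => //; lia.
move=> k; rewrite mem_filter mem_iota => /andP[/andP[/allP low /eqP Ek] kn].
rewrite leqNgt; apply/negP => lt_k.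
have Sk := @psum_negrev_motzkin_cat p a q (k.-2 - size p) mp.
have Ekk : size p + (k.-2 - size p).+1 = k.-1 by lia.
have posk : (0 <= psum q (k.-2 - size p))%R by apply: pos; lia.
rewrite Ekk Ek in Sk.
case/orP: a1 => /eqP Ea; last by lia.
have S1 := @psum_negrev_motzkin_cat p a q 0 mp; rewrite psum0 in S1.
(* For [k = size p + 2] the height 0 sits at index [k.-1], where 1 is required; for larger [k] it
   falls among the indices up to [k - 2], which [low] governs. *)
have [Ek2|lt_k2] := leqP k (size p).+2.
  have E0 : k.-2 - size p = 0 by lia.
  by move: Sk; rewrite E0 psum0; lia.
have := low (size p + 1); rewrite mem_iota S1 Ea.
by move=> H; have := H ltac:(lia); lia.
Qed.

(** * Decomposing words that start with an up step *)

Lemma split_negrev p k : k < size p ->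
  p = negrev (negrev (take k p)) ++ nth 0%R p k :: drop k.+1 p.
Proof. by move=> lt_k; rewrite negrevK -drop_nth // cat_take_drop. Qed.

(** Measured from the final height 1, heights at least 1 become nonnegative and the starting height
    0 becomes the final -1. *)
Lemma motzkin_word_negrev_take p m : steps p -> m <= size p ->
  (forall j, 0 < j < m -> (1 <= psum p j)%R) -> 0 < m -> psum p m = 1%R ->
  motzkin_word (negrev (take m p)).
Proof.
move=> st le_m low m0 Em; rewrite /motzkin_word size_negrev size_takel //; split.
- rewrite steps_negrev; move: st; rewrite -{1}(cat_take_drop m p) /steps all_cat.
  by case/andP.
- move=> j lt_j; have le_j := ltnW lt_j; rewrite psum_negrev size_takel //.
  rewrite !psum_take ?leq_subr // Em.
  case: j lt_j {le_j} => [|j] lt_j; first by rewrite subn0 Em.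
  by have := low (m - j.+1); lia.
- by rewrite psum_negrev size_takel // subnn psum0 psum_take // Em.
Qed.

(** Cut at the first return to 0: earlier positive times have height at least 1, so the returning
    step goes from 1 to 0. *)
Lemma motzkin_word_split w : motzkin_word w -> psum w 1 = 1%R ->
  exists p1 p2, [/\ motzkin_word p1, motzkin_word p2 &
                    w = negrev p1 ++ (-1)%R :: p2].
Proof.
move=> mw w1; have lastw := motzkin_word_last mw; have [st pos tot] := mw.
have w0 := motzkin_word_size mw.
(* A return to 0 exists just before the last step; a one-letter word is excluded, since its total
   would be 1. *)
have Pw : (0 < (size w).-1) && (psum w (size w).-1 == 0%R).
  rewrite lastw eqxx andbT lt0n; apply/negP => /eqP Ew.
  have Ew1 : size w = 1 by lia.
  by move: tot; rewrite Ew1 w1.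
have exk : exists k, (0 < k) && (psum w k == 0%R) by exists (size w).-1.
case: (ex_minnP exk) => k /andP[k0 /eqP Ek] mink.
have ltk := mink _ Pw.
case: k k0 Ek mink ltk => // m _ Ek mink ltm.
have lt_mw : m < size w by lia.
have low j : 0 < j < m.+1 -> (1 <= psum w j)%R.
  move=> /andP[j0 jm]; have := mink j; have := pos j; rewrite j0 /=.
  by move=> /(_ ltac:(lia)); case: eqP => [_ _ /(_ isT)|]; lia.
have m0 : 0 < m by case: m Ek {mink ltm lt_mw low} => //; rewrite w1.
have Sm := psumS lt_mw; rewrite Ek in Sm.
have lm : (1 <= psum w m)%R by apply: low; lia.
have [Em Enth] : psum w m = 1%R /\ nth 0%R w m = (-1)%R.
  by case: (steps_nth m st) Sm => ->; split; lia.
exists (negrev (take m w)), (drop m.+1 w); split.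
- by apply: motzkin_word_negrev_take => //; [lia | move=> j jm; apply: low; lia].
- split.
  + move: st; rewrite -{1}(cat_take_drop m.+1 w) /steps all_cat.
    by case/andP.
  + move=> j; rewrite size_drop => lt_j; rewrite psum_drop // Ek subr0.
    by apply: pos; lia.
  + by rewrite psum_drop // Ek subr0 size_drop subnKC.
- by rewrite -Enth; apply: split_negrev.
Qed.

(** Cut at the last [m] at height 1 before which the walk never drops below 1. A flat step there
    would give a later such [m]; a down step lands on 0 and positivity bounds the rest; an up step
    lands on 2, and a return to 1 would again give a later [m]. *)
Lemma positive_word_split w : positive_word w -> 0 < size w -> psum w 1 = 1%R ->
  (exists2 p1, motzkin_word p1 & w = negrev p1) \/
  (exists p1 a p2, [/\ motzkin_word p1, positive_word p2, (a == (-1)%R) || (a == 1%R) &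
                    w = negrev p1 ++ a :: p2]).
Proof.
move=> [st pos] w0 w1.
(* [m] plays the role of [k - 1] in the definition of [last_one]. *)
pose P m := [&& 0 < m <= size w, all (fun j => 1 <= psum w j)%R (iota 1 m)
              & psum w m == 1%R].
have exm : exists m, P m by exists 1; rewrite /P /= w1 w0.
have bdm m : P m -> m <= size w by case/and3P=> /andP[].
case: (ex_maxnP exm bdm) => m /and3P[/andP[m0 le_m] /allP low /eqP Em] maxm.
have mp1 : motzkin_word (negrev (take m w)).
  apply: motzkin_word_negrev_take => // j jm; apply: low.
  by rewrite mem_iota; lia.
case: (ltnP m (size w)) => [lt_m|ge_m]; [right|left]; last first.
  by exists (negrev (take m w)); rewrite // negrevK take_oversize.
have Sm := psumS lt_m; rewrite Em in Sm.
have nS j : m < j <= size w -> (forall i, m < i <= j -> (1 <= psum w i)%R) -> psum w j <> 1%R.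
  move=> /andP[mj jw] H E1; suff /maxm : P j by lia.
  apply/and3P; split; [lia | | by rewrite E1].
  apply/allP=> i; rewrite mem_iota => ij.
  by case: (leqP i m) => im; [apply: low; rewrite mem_iota; lia | apply: H; lia].
have st2 : steps (drop m.+1 w).
  by move: st; rewrite -{1}(cat_take_drop m.+1 w) /steps all_cat; case/andP.
exists (negrev (take m w)), (nth 0%R w m), (drop m.+1 w); split=> //.
- split=> // j; rewrite size_drop => le_j; rewrite psum_drop // subr_ge0.
  case: (steps_nth m st) Sm => -> Sm.
  + by rewrite Sm; apply: pos; lia.
  + by case: (nS m.+1) => [|i im|]; [lia | have -> : i = m.+1 by lia | ]; rewrite Sm.
  have {}Sm : psum w m.+1 = 2%R by rewrite Sm.
  rewrite Sm => {st2}.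
  (* Induction on a bound for the distance from [m.+1]: one step from height at least 2 reaches at
     least 1, and 1 itself is excluded by [nS]. *)
  suff H : forall d, forall i, i <= d -> m.+1 + i <= size w -> (2 <= psum w (m.+1 + i))%R.
    by apply: (H j); lia.
  elim=> [|d IH] i; first by rewrite leqn0 => /eqP-> _; rewrite addn0 Sm.
  rewrite leq_eqVlt ltnS => /orP[/eqP->|]; last exact: IH.
  move=> le_w; have Hd := IH d (leqnn _) ltac:(lia).
  have SS := @psumS w (m.+1 + d) ltac:(lia).
  rewrite -addnS in SS.
  have l1 : (1 <= psum w (m.+1 + d.+1))%R by case: (steps_nth (m.+1 + d) st) SS => ->; lia.
  have n1 : psum w (m.+1 + d.+1) <> 1%R.
    apply: nS => [|i' /andP[mi id]]; first by lia.
    have -> : i' = m.+1 + (i' - m.+1) by lia.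
    have [le_d|gt_d] := leqP (i' - m.+1) d.
      by have := IH _ le_d; lia.
    by have -> : i' - m.+1 = d.+1 by lia.
  by case: (steps_nth (m.+1 + d) st) SS l1 Hd => ->; lia.
- case: (steps_nth m st) Sm => -> Sm //.
  by case: (nS m.+1) => [|i im|]; [lia | have -> : i = m.+1 by lia | ]; rewrite Sm.
- exact: split_negrev.
Qed.

(** * Paths and trees with arbitrary labels *)

Definition step_ok (a : int) (x y : nat) : Prop :=
  (a = (-1)%R -> x < y) /\ (a = 1%R -> y < x).

Definition compatible (p : seq int) (s : seq nat) : Prop :=
  size s = (size p).+1 /\
  forall i, i < size p -> step_ok (nth 0%R p i) (nth 0 s i) (nth 0 s i.+1).

Lemma compatible_cons a p x s :
  compatible (a :: p) (x :: s) <-> step_ok a x (head 0 s) /\ compatible p s.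
Proof.
split=> [[[sz] ok]|[ok [sz oks]]]; last first.
  by split=> [|[|i] lt_i] /=; rewrite ?sz ?nth0 //; apply: oks.
split; first by have := ok 0; rewrite /= nth0; apply.
by split=> // i lt_i; have := ok i.+1; apply.
Qed.

Lemma compatible_cat p1 a p2 s1 s2 : size s1 = (size p1).+1 ->
  compatible (p1 ++ a :: p2) (s1 ++ s2) <->
  [/\ compatible p1 s1, step_ok a (last 0 s1) (head 0 s2) & compatible p2 s2].
Proof.
elim: p1 s1 => [|b p1 IH] [|x s1] //= [sz].
  case: s1 sz => //= _; rewrite compatible_cons.
  by split=> [[]|[]].
have last_s1 : last x s1 = last 0 s1 by case: s1 sz {IH}.
have head_s1 : head 0 (s1 ++ s2) = head 0 s1 by case: s1 sz {IH last_s1}.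
rewrite compatible_cons IH // last_s1 head_s1.
split=> [[ok [c1 ok' c2]]|[/compatible_cons[ok c1] ok' c2]] //.
by split=> //; apply/compatible_cons.
Qed.

(** Reversal exchanges the two neighbours of a step and negation exchanges the two inequalities. *)
Lemma compatible_negrev p s : compatible p s -> compatible (negrev p) (rev s).
Proof.
move=> [sz ok]; split; rewrite size_negrev ?size_rev // => i lt_i.
rewrite nth_negrev // !nth_rev ?sz; try lia.
have [] := ok (size p - i.+1) ltac:(lia).
rewrite subSS; have -> : (size p - i.+1).+1 = size p - i by lia.
by move=> H1 H2; split=> Ea; [apply: H2|apply: H1]; lia.
Qed.

Lemma last_rev (T : Type) (x : T) s : last x (rev s) = head x s.
Proof. by case: s => // y s; rewrite rev_cons last_rcons. Qed.

(* [motzkin_tree p s t] says that [t] is the image of the path [(p, s)] under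
   the map [Phi], extended to arbitrary distinct labels so that no relabelling
   is needed in the recursion; likewise for [positive_tree] and [Phi']. *)
Inductive motzkin_tree : seq int -> seq nat -> btree -> Prop :=
| motzkin_cherry a b : a < b ->
    motzkin_tree [:: (-1)%R] [:: a; b] (BNode false (BLeaf false a) (BLeaf false b))
| motzkin_leaf a p s t : motzkin_tree p s t ->
    motzkin_tree (0%R :: p) (a :: s) (BNode false (BLeaf false a) t)
| motzkin_node p1 s1 t1 p2 s2 t2 :
    motzkin_tree p1 s1 t1 -> motzkin_tree p2 s2 t2 -> head 0 s1 < head 0 s2 ->
    motzkin_tree (negrev p1 ++ (-1)%R :: p2) (rev s1 ++ s2) (BNode false t1 t2).

(** Computing the middle step from the labels makes the word a function of the two subpaths. Equal
    first labels default to 1, so the sign is right only for distinct labels. *)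
Definition joint (s1 s2 : seq nat) : int :=
  if head 0 s1 < head 0 s2 then (-1)%R else 1%R.

Inductive positive_tree : seq int -> seq nat -> btree -> Prop :=
| positive_single a : positive_tree [::] [:: a] (BLeaf true a)
| positive_leaf a p s t : positive_tree p s t ->
    positive_tree (0%R :: p) (a :: s) (BNode false (BLeaf false a) t)
| positive_root p s t : motzkin_tree p s t ->
    positive_tree (negrev p) (rev s) (mark_root t)
| positive_node p1 s1 t1 p2 s2 t2 :
    motzkin_tree p1 s1 t1 -> positive_tree p2 s2 t2 ->
    positive_tree (negrev p1 ++ joint s1 s2 :: p2) (rev s1 ++ s2) (BNode false t1 t2).

Lemma joint_unit s1 s2 : (joint s1 s2 == (-1)%R) || (joint s1 s2 == 1%R).
Proof. by rewrite /joint; case: ifP. Qed.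

(** * Invariants of the two relations *)

Lemma motzkin_tree_word p s t : motzkin_tree p s t -> motzkin_word p.
Proof.
elim=> {p s t} *; [exact: motzkin_word_down|exact: motzkin_word_flat|].
exact: motzkin_word_node.
Qed.

Lemma positive_tree_word p s t : positive_tree p s t -> positive_word p.
Proof.
elim=> {p s t} [a|a p s t _ IH|p s t mt|p1 s1 t1 p2 s2 t2 mt _ IH].
- by split=> // -[].
- exact: positive_word_flat.
- exact: positive_word_negrev (motzkin_tree_word mt).
- exact: positive_word_node (motzkin_tree_word mt) IH (joint_unit _ _).
Qed.

Lemma motzkin_tree_compatible p s t : motzkin_tree p s t -> compatible p s.
Proof.
elim=> {p s t} [a b ab|a p s t _ IH|p1 s1 t1 p2 s2 t2 _ IH1 _ IH2 lt12].
- by split=> // -[].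
- by apply/compatible_cons.
- apply/compatible_cat; first by rewrite size_rev size_negrev; case: IH1.
  by split=> //; [exact: compatible_negrev|rewrite last_rev].
Qed.

Lemma motzkin_tree_size p s t : motzkin_tree p s t -> size s = (size p).+1.
Proof. by case/motzkin_tree_compatible. Qed.

Lemma motzkin_tree_size_gt1 p s t : motzkin_tree p s t -> 1 < size s.
Proof.
move=> mt; rewrite (motzkin_tree_size mt) ltnS.
exact: motzkin_word_size (motzkin_tree_word mt).
Qed.

Lemma motzkin_tree_leaves p s t : motzkin_tree p s t -> perm_eq (leaves t) s.
Proof.
elim=> {p s t} [a b ab|a p s t _ IH|p1 s1 t1 p2 s2 t2 _ IH1 _ IH2 lt12] //=.
- by rewrite perm_cons.
- by rewrite perm_cat // perm_sym perm_rev perm_sym.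
Qed.

Lemma leaves_mark_root t : leaves (mark_root t) = leaves t.
Proof. by case: t. Qed.

Lemma nmarks_mark_root t : nmarks t = 0 -> nmarks (mark_root t) = 1.
Proof. by case: t => //= [m a b]; lia. Qed.

Lemma positive_tree_leaves p s t : positive_tree p s t -> perm_eq (leaves t) s.
Proof.
elim=> {p s t} [a|a p s t _ IH|p s t /motzkin_tree_leaves mt|
                p1 s1 t1 p2 s2 t2 /motzkin_tree_leaves mt _ IH] //=.
- by rewrite perm_cons.
- by rewrite leaves_mark_root perm_sym perm_rev perm_sym.
- by rewrite perm_cat // perm_sym perm_rev perm_sym.
Qed.

Lemma motzkin_tree_nmarks p s t : motzkin_tree p s t -> nmarks t = 0.
Proof. by elim=> {p s t} //= *; lia. Qed.

Lemma positive_tree_nmarks p s t : positive_tree p s t -> nmarks t = 1.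
Proof.
elim=> {p s t} [a|a p s t _ IH|p s t /motzkin_tree_nmarks mt|
                p1 s1 t1 p2 s2 t2 /motzkin_tree_nmarks mt _ IH] //=.
- exact: nmarks_mark_root.
- by rewrite mt IH.
Qed.

Lemma step_ok_joint s1 s2 : uniq (rev s1 ++ s2) -> 0 < size s1 -> 0 < size s2 ->
  step_ok (joint s1 s2) (head 0 s1) (head 0 s2).
Proof.
case: s1 s2 => // x s1 [//|y s2] un _ _; rewrite /joint /=.
case: ltngtP => // Exy; split=> //.
by move: un; rewrite cat_uniq /= mem_rev Exy mem_head orTb andbF.
Qed.

Lemma step_ok_jointE s1 s2 a : (a == (-1)%R) || (a == 1%R) ->
  step_ok a (head 0 s1) (head 0 s2) -> a = joint s1 s2.
Proof.
rewrite /joint => /orP[]/eqP-> [ok1 ok2]; first by rewrite ok1.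
by rewrite ltnNge ltnW ?ok2.
Qed.

(** [positive_node], unlike [motzkin_node], carries no strict inequality between first labels;
    [uniq s] excludes a tie. *)
Lemma positive_tree_compatible p s t :
  positive_tree p s t -> uniq s -> compatible p s.
Proof.
elim=> {p s t} [a|a p s t _ IH /= /andP[_ us]|p s t mt us|
                p1 s1 t1 p2 s2 t2 mt _ IH us].
- by split.
- by apply/compatible_cons; split=> //; exact: IH.
- exact: compatible_negrev (motzkin_tree_compatible mt).
- have ok1 := motzkin_tree_compatible mt.
  have [us1 us2] : uniq s1 /\ uniq s2.
    by move: us; rewrite cat_uniq rev_uniq => /and3P[].
  have ok2 := IH us2.
  apply/compatible_cat; first by rewrite size_rev size_negrev; case: ok1.
  split=> //; first exact: compatible_negrev.
  by rewrite last_rev; apply: step_ok_joint => //; [case: ok1 => ->|case: ok2 => ->].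
Qed.

(** * Every path has a tree *)

(** Strong induction on the length, split on the first step: down gives the cherry, flat gives
    [motzkin_leaf], up calls for the decomposition at the first return. *)
Lemma motzkin_tree_exists p s :
  motzkin_word p -> compatible p s -> exists t, motzkin_tree p s t.
Proof.
have [n] := ubnP (size p); elim: n p s => // n IH p s le_n mp cp.
have := motzkin_word_size mp; have [st pos tot] := mp.
case: p => // a p in le_n mp cp st pos tot * => _.
case: s cp => [[]//|x s] /compatible_cons[ok cp].
have Ea : psum (a :: p) 1 = a by rewrite psum_cons psum0 addr0.
case: (steps_nth 0 st) => /= E; rewrite {}E {a} in le_n mp st pos tot ok Ea *.
- case: p => [|b p] in le_n mp cp st pos tot ok Ea *.
    case: s cp ok => [[]//|y [|z s] []] //= _ _ [lt_xy _].
    by exists (BNode false (BLeaf false x) (BLeaf false y)); constructor; apply: lt_xy.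
  (* A first down step followed by further letters would reach -1 too early. *)
  by have := pos 1 isT; rewrite Ea.
- have [||t mt] := IH p s _ _ cp; first by [].
    have sz : 0 < size p by case: p tot {le_n mp cp st pos ok Ea}.
    split=> [|j lt_j|]; first by case/andP: st.
      by have := pos j.+1 lt_j; rewrite psum_cons add0r.
    by have := tot; rewrite /= psum_cons add0r.
  by exists (BNode false (BLeaf false x) t); constructor.
have [p1 [p2 [mp1 mp2 Ep]]] := motzkin_word_split mp Ea.
have {cp ok} cp : compatible (1%R :: p) (x :: s) by apply/compatible_cons.
rewrite Ep in le_n cp *; rewrite size_cat size_negrev /= in le_n.
have sz : size (take (size p1).+1 (x :: s)) = (size p1).+1.
  rewrite size_takel //; case: cp => ->.
  by rewrite size_cat size_negrev /=; lia.
rewrite -(cat_take_drop (size p1).+1 (x :: s)) in cp *.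
move: (take _ _) (drop _ _) sz cp => s1 s2 sz /compatible_cat[].
  by rewrite size_negrev.
move=> cp1 ok cp2.
have [||t1 mt1] := IH p1 (rev s1) _ mp1; first by lia.
  by rewrite -[p1]negrevK; exact: compatible_negrev.
have [|t2 mt2] := IH p2 s2 _ mp2 cp2; first by lia.
exists (BNode false t1 t2); rewrite -[s1]revK; constructor=> //.
(* The label just before the down step is the last of [s1], hence the first label of the reversed
   subpath. *)
by case: ok => /(_ erefl); rewrite -[in last _ _](revK s1) last_rev.
Qed.

(** The sign found in the decomposition has to be [joint], because the label constraints admit only
    one. *)
Lemma positive_tree_exists p s :
  positive_word p -> compatible p s -> exists t, positive_tree p s t.
Proof.
have [n] := ubnP (size p); elim: n p s => // n IH p s le_n mp cp.
have [st pos] := mp.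
case: p => [|a p] in le_n mp cp st pos *.
  by case: s cp => [|x [|y s]] [] // _ _; exists (BLeaf true x); constructor.
case: s cp => [[]//|x s] /compatible_cons[ok cp].
have Ea : psum (a :: p) 1 = a by rewrite psum_cons psum0 addr0.
case: (steps_nth 0 st) => /= E; rewrite {}E {a} in le_n mp st pos ok Ea *.
- by have := pos 1 isT; rewrite Ea.
- have [||t mt] := IH p s _ _ cp; first by [].
    split=> [|j lt_j]; first by case/andP: st.
    by have := pos j.+1 lt_j; rewrite psum_cons add0r.
  by exists (BNode false (BLeaf false x) t); constructor.
have {cp ok} cp : compatible (1%R :: p) (x :: s) by apply/compatible_cons.
have [[p1 mp1 Ep]|[p1 [a [p2 [mp1 mp2 a1 Ep]]]]] := positive_word_split mp isT Ea.
  have [|t mt] := @motzkin_tree_exists p1 (rev (x :: s)) mp1.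
    by rewrite -[p1]negrevK -Ep; exact: compatible_negrev.
  by exists (mark_root t); rewrite Ep -[x :: s]revK; constructor.
rewrite Ep in le_n cp *; rewrite size_cat size_negrev /= in le_n.
have sz : size (take (size p1).+1 (x :: s)) = (size p1).+1.
  rewrite size_takel //; case: cp => ->.
  by rewrite size_cat size_negrev /=; lia.
rewrite -(cat_take_drop (size p1).+1 (x :: s)) in cp *.
move: (take _ _) (drop _ _) sz cp => s1 s2 sz /compatible_cat[].
  by rewrite size_negrev.
move=> cp1 ok cp2.
have [|t1 mt1] := @motzkin_tree_exists p1 (rev s1) mp1.
  by rewrite -[p1]negrevK; exact: compatible_negrev.
have [|t2 mt2] := IH p2 s2 _ mp2 cp2; first by lia.
rewrite -[s1]revK last_rev in ok *; rewrite (step_ok_jointE a1 ok).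
by exists (BNode false t1 t2); constructor.
Qed.

(** * Tree isomorphism: the relations reach every tree and the tree determines the path *)

Lemma tree_iso_refl t : tree_iso t t.
Proof. by elim: t => *; constructor. Qed.

Lemma tree_iso_sym t t' : tree_iso t t' -> tree_iso t' t.
Proof.
elim=> {t t'} [m l|m a b a' b' _ IHa _ IHb|m a b a' b' _ IHa _ IHb].
- by constructor.
- by constructor.
- exact: iso_swap.
Qed.

Lemma tree_iso_leaves t t' : tree_iso t t' -> perm_eq (leaves t) (leaves t').
Proof.
elim=> {t t'} [m l|m a b a' b' _ IHa _ IHb|m a b a' b' _ IHa _ IHb] //=.
  exact: perm_cat.
by rewrite perm_catC perm_cat.
Qed.

Lemma size_leaves_gt0 t : 0 < size (leaves t).
Proof. by elim: t => //= m a IHa b IHb; rewrite size_cat; lia. Qed.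

(** The tree of a Motzkin path is never a leaf; this dichotomy on a child selects the
    constructor. *)
Lemma leaf_or_big t : (exists m l, t = BLeaf m l) \/ 1 < size (leaves t).
Proof.
case: t => [m l|m a b]; [by left; exists m, l|right].
by rewrite /= size_cat; move: (size_leaves_gt0 a) (size_leaves_gt0 b); lia.
Qed.

(** Structural induction, swapping children where needed: a single leaf child goes first, two leaves
    are ordered by label, two larger children by the first labels of their paths. *)
Lemma motzkin_tree_surj t : uniq (leaves t) -> nmarks t = 0 -> 1 < size (leaves t) ->
  exists p s t', motzkin_tree p s t' /\ tree_iso t' t.
Proof.
elim: t => //= m a IHa b IHb; rewrite cat_uniq => /and3P[ua dis ub] m0 _.
have [E Ea Eb] : [/\ m = false, nmarks a = 0 & nmarks b = 0].
  by case: m m0 => /=; split; lia.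
subst m; case: (leaf_or_big a) => [[m [x Da]]|biga].
  have Dm : m = false by move: Ea; rewrite Da; case: m {Da}.
  subst a m; case: (leaf_or_big b) => [[m [y Db]]|bigb].
    have Dm : m = false by move: Eb; rewrite Db; case: m {Db}.
    subst b m; case: (ltngtP x y) => [xy|yx|E].
    + by do 3!eexists; split; [exact: motzkin_cherry xy|exact: tree_iso_refl].
    + do 3!eexists; split; first exact: motzkin_cherry yx.
      by apply: iso_swap; constructor.
    + by move: dis; rewrite E /= mem_head.
  have [p [s [t [mt it]]]] := IHb ub Eb bigb.
  do 3!eexists; split; first exact: motzkin_leaf x _ _ _ mt.
  by constructor; first constructor.
have [p [s [t [mt it]]]] := IHa ua Ea biga.
case: (leaf_or_big b) => [[m [y Db]]|bigb].
  have Dm : m = false by move: Eb; rewrite Db; case: m {Db}.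
  subst b m; do 3!eexists; split; first exact: motzkin_leaf y _ _ _ mt.
  by apply: iso_swap; first constructor.
have [p2 [s2 [t2 [mt2 it2]]]] := IHb ub Eb bigb.
(* The first labels are leaves of two subtrees with disjoint label sets. *)
have ne : head 0 s <> head 0 s2.
  have hs : head 0 s \in leaves t.
    rewrite (perm_mem (motzkin_tree_leaves mt)).
    by case: s mt => [/motzkin_tree_size_gt1|] // x s _; exact: mem_head.
  have hs2 : head 0 s2 \in leaves t2.
    rewrite (perm_mem (motzkin_tree_leaves mt2)).
    by case: s2 mt2 => [/motzkin_tree_size_gt1|] // x s2 _; exact: mem_head.
  move=> E; move/hasP: dis; case; exists (head 0 s2).
    by rewrite -(perm_mem (tree_iso_leaves it2)).
  by rewrite -E -(perm_mem (tree_iso_leaves it)).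
case: (ltngtP (head 0 s) (head 0 s2)) => // lt.
  by do 3!eexists; split; [exact: motzkin_node mt mt2 lt|constructor].
by do 3!eexists; split; [exact: motzkin_node mt2 mt lt|apply: iso_swap].
Qed.

Lemma tree_iso_nodeE m a b m' a' b' : tree_iso (BNode m a b) (BNode m' a' b') ->
  m = m' /\ ((tree_iso a a' /\ tree_iso b b') \/ (tree_iso a b' /\ tree_iso b a')).
Proof. by move=> H; inversion H; subst; split=> //; [left|right]. Qed.

Lemma tree_iso_leafl m l t : tree_iso (BLeaf m l) t -> t = BLeaf m l.
Proof. by move=> H; inversion H. Qed.

Lemma tree_iso_leafr m l t : tree_iso t (BLeaf m l) -> t = BLeaf m l.
Proof. by move=> H; inversion H. Qed.

Lemma tree_iso_nmarks t t' : tree_iso t t' -> nmarks t = nmarks t'.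
Proof. by elim=> {t t'} //= *; lia. Qed.

Lemma tree_iso_mark_root t t' :
  tree_iso t t' -> tree_iso (mark_root t) (mark_root t').
Proof. by case=> *; [constructor|constructor|apply: iso_swap]. Qed.

Lemma motzkin_tree_node p s t :
  motzkin_tree p s t -> exists a b, t = BNode false a b.
Proof. by case=> *; do 2!eexists. Qed.

(** [mark_root] overwrites the old mark; nothing is lost here, both roots being unmarked nodes. *)
Lemma motzkin_tree_mark_root_iso p s t p' s' t' :
  motzkin_tree p s t -> motzkin_tree p' s' t' ->
  tree_iso (mark_root t) (mark_root t') -> tree_iso t t'.
Proof.
move=> /motzkin_tree_node[a [b ->]] /motzkin_tree_node[a' [b' ->]] /=.
by move=> /tree_iso_nodeE[_ [[]|[]]] *; [constructor|apply: iso_swap].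
Qed.

Lemma positive_tree_surj t : uniq (leaves t) -> nmarks t = 1 ->
  exists p s t', positive_tree p s t' /\ tree_iso t' t.
Proof.
elim: t => [[] l // _ _|m a IHa b IHb /=].
  by exists [::], [:: l], (BLeaf true l); split; constructor.
(* The unmarked child [c] goes first: a leaf gives [positive_leaf], anything larger
   [positive_node]. *)
have join c d : uniq (leaves c) -> nmarks c = 0 ->
    (exists p s t', positive_tree p s t' /\ tree_iso t' d) ->
    exists p s t', positive_tree p s t' /\ tree_iso t' (BNode false c d).
  move=> uc c0 [p [s [t [pt it]]]]; case: (leaf_or_big c) => [[k [x Dc]]|bigc].
    have Dk : k = false by move: c0; rewrite Dc; case: k {Dc}.
    rewrite {}Dc {}Dk; do 3!eexists; split; first exact: positive_leaf x _ _ _ pt.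
    by constructor; first constructor.
  have [p1 [s1 [t1 [mt1 it1]]]] := motzkin_tree_surj uc c0 bigc.
  by do 3!eexists; split; [exact: positive_node mt1 pt|constructor].
move=> un; case: (un); rewrite cat_uniq => /and3P[ua _ ub].
case: m => /= E; last first.
  case: (posnP (nmarks a)) => a0.
    by apply: join => //; apply: IHb => //; lia.
  have [||p [s [t [pt it]]]] := join b a ub; first by lia.
    by apply: IHa => //; lia.
  (* The mark lies in the left child, so the tree was built with the children exchanged and the
     isomorphism is composed with a swap. *)
  exists p, s, t; split=> //; move: it => /tree_iso_sym it; apply: tree_iso_sym.
  by inversion it; subst; [apply: iso_swap|constructor].
(* The root is marked: its unmarked copy comes from a Motzkin path. *)
have [|||p [s [t [mt it]]]] := @motzkin_tree_surj (BNode false a b) => //=.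
- by lia.
- by rewrite size_cat; move: (size_leaves_gt0 a) (size_leaves_gt0 b); lia.
do 3!eexists; split; first exact: positive_root mt.
exact: (tree_iso_mark_root it).
Qed.

(** The number of leaf children of the root tells the constructor. Within one constructor, a crossed
    matching of the children contradicts the order of labels or turns a node into a leaf. *)
Lemma motzkin_tree_inj p s t p' s' t' : motzkin_tree p s t ->
  motzkin_tree p' s' t' -> tree_iso t t' -> p = p' /\ s = s'.
Proof.
move=> mt; elim: mt p' s' t' => {p s t}
  [a b ab|a p s t mt IH|p1 s1 t1 p2 s2 t2 mt1 IH1 mt2 IH2 lt12] p' s' t' mt'.
- case: mt' => {p' s' t'} [a' b' ab'|a' p' s' t' mt'|p1' s1' t1' p2' s2' t2' mt1' mt2' lt12'].
  + case/tree_iso_nodeE=> _ [] [/tree_iso_leafl[Ea] /tree_iso_leafl[Eb]].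
      by rewrite Ea Eb.
    by move: ab ab'; rewrite Ea Eb; lia.
  + have [c [d ->]] := motzkin_tree_node mt'.
    by case/tree_iso_nodeE=> _ [] [/tree_iso_leafl ? /tree_iso_leafl].
  + have [c [d ->]] := motzkin_tree_node mt1'.
    by case/tree_iso_nodeE=> _ [] [/tree_iso_leafl ? /tree_iso_leafl].
- case: mt' => {p' s' t'} [a' b' ab'|a' p' s' t' mt'|p1' s1' t1' p2' s2' t2' mt1' mt2' lt12'].
  + have [c [d ->]] := motzkin_tree_node mt.
    by case/tree_iso_nodeE=> _ [] [? /tree_iso_leafr].
  + case/tree_iso_nodeE=> _ [] [/tree_iso_leafl E it].
      by case: E => ->; have [-> ->] := IH _ _ _ mt' it.
    by have [c [d Et]] := motzkin_tree_node mt'; rewrite Et in E.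
  + have [c [d ->]] := motzkin_tree_node mt1'.
    have [c' [d' ->]] := motzkin_tree_node mt2'.
    by case/tree_iso_nodeE=> _ [] [/tree_iso_leafl].
- case: mt' => {p' s' t'} [a' b' ab'|a' p' s' t' mt'|p1' s1' t1' p2' s2' t2' mt1' mt2' lt12'].
  + have [c [d ->]] := motzkin_tree_node mt1.
    by case/tree_iso_nodeE=> _ [] [/tree_iso_leafr].
  + have [c [d Et1]] := motzkin_tree_node mt1.
    have [c' [d' Et2]] := motzkin_tree_node mt2.
    rewrite Et1 Et2.
    by case/tree_iso_nodeE=> _ [] [it1 it2]; [move/tree_iso_leafr: it1|move/tree_iso_leafr: it2].
  + case/tree_iso_nodeE=> _ [] [it1 it2].
      by have [-> ->] := IH1 _ _ _ mt1' it1; have [-> ->] := IH2 _ _ _ mt2' it2.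
    (* In the crossed matching the two first labels would be ordered both ways. *)
    have [_ E1] := IH1 _ _ _ mt2' it1; have [_ E2] := IH2 _ _ _ mt1' it2.
    by move: lt12 lt12'; rewrite E1 E2; lia.
Qed.

(** The mark at the root and the shape of the unmarked child tell the constructors apart; a crossed
    matching would pair a marked subtree with an unmarked one. *)
Lemma positive_tree_inj p s t p' s' t' : positive_tree p s t ->
  positive_tree p' s' t' -> tree_iso t t' -> p = p' /\ s = s'.
Proof.
move=> pt; elim: pt p' s' t' => {p s t}
  [a|a p s t pt IH|p s t mt|p1 s1 t1 p2 s2 t2 mt1 pt2 IH2] p' s' t' pt'.
- case: pt' => {p' s' t'} [a'|a' p' s' t' pt'|p' s' t' mt'|p1' s1' t1' p2' s2' t2' mt1' pt2'].
  + by case/tree_iso_leafl=> ->.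
  + by move/tree_iso_leafl.
  + by have [c [d ->]] := motzkin_tree_node mt' => /tree_iso_leafl.
  + by move/tree_iso_leafl.
- case: pt' => {p' s' t'} [a'|a' p' s' t' pt'|p' s' t' mt'|p1' s1' t1' p2' s2' t2' mt1' pt2'].
  + by move/tree_iso_leafr.
  + case/tree_iso_nodeE=> _ [] [it1 it2].
      by case/tree_iso_leafl: it1 => ->; have [-> ->] := IH _ _ _ pt' it2.
    by have := tree_iso_nmarks it1; rewrite (positive_tree_nmarks pt').
  + by have [c [d ->]] := motzkin_tree_node mt' => /tree_iso_nodeE[].
  + case/tree_iso_nodeE=> _ [] [it1 it2].
      by have [c [d Et]] := motzkin_tree_node mt1'; move/tree_iso_leafl: it1; rewrite Et.
    by have := tree_iso_nmarks it1; rewrite (positive_tree_nmarks pt2').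
- case: pt' => {p' s' t'} [a'|a' p' s' t' pt'|p' s' t' mt'|p1' s1' t1' p2' s2' t2' mt1' pt2'].
  + by have [c [d ->]] := motzkin_tree_node mt => /tree_iso_leafr.
  + by have [c [d ->]] := motzkin_tree_node mt => /tree_iso_nodeE[].
  + move=> /(motzkin_tree_mark_root_iso mt mt') it.
    by have [-> ->] := motzkin_tree_inj mt mt' it.
  + by have [c [d ->]] := motzkin_tree_node mt => /tree_iso_nodeE[].
- case: pt' => {p' s' t'} [a'|a' p' s' t' pt'|p' s' t' mt'|p1' s1' t1' p2' s2' t2' mt1' pt2'].
  + by move/tree_iso_leafr.
  + case/tree_iso_nodeE=> _ [] [it1 it2].
      by have [c [d Et]] := motzkin_tree_node mt1; move/tree_iso_leafr: it1; rewrite Et.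
    by have := tree_iso_nmarks it2; rewrite (positive_tree_nmarks pt2).
  + by have [c [d ->]] := motzkin_tree_node mt' => /tree_iso_nodeE[].
  + case/tree_iso_nodeE=> _ [] [it1 it2].
      have [-> ->] := motzkin_tree_inj mt1 mt1' it1.
      by have [-> ->] := IH2 _ _ _ pt2' it2.
    have := tree_iso_nmarks it1.
    by rewrite (positive_tree_nmarks pt2') (motzkin_tree_nmarks mt1).
Qed.

(** * Relabelling, and evaluation of [phi] and [phi'] *)

Lemma head_map (f : nat -> nat) s : 0 < size s -> head 0 (map f s) = f (head 0 s).
Proof. by case: s. Qed.

(** Only comparisons between labels enter the relation, so monotonicity on the labels present
    suffices. *)
Lemma motzkin_tree_relabel f p s t : motzkin_tree p s t ->
  {in s &, {mono f : x y / x < y}} -> motzkin_tree p (map f s) (relabel f t).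
Proof.
elim=> {p s t} [a b ab|a p s t mt IH|p1 s1 t1 p2 s2 t2 mt1 IH1 mt2 IH2 lt12] mono /=.
- by constructor; rewrite mono ?inE ?eqxx ?orbT.
- constructor; apply: IH => x y xs ys; apply: mono; exact/mem_behead.
- have sub1 : {subset s1 <= rev s1 ++ s2} by move=> x xs; rewrite mem_cat mem_rev xs.
  have sub2 : {subset s2 <= rev s1 ++ s2} by move=> x xs; rewrite mem_cat xs orbT.
  have h1 : 0 < size s1 by exact: ltnW (motzkin_tree_size_gt1 mt1).
  have h2 : 0 < size s2 by exact: ltnW (motzkin_tree_size_gt1 mt2).
  rewrite map_cat map_rev; constructor.
  + by apply: IH1 => x y xs ys; apply: mono; exact: sub1.
  + by apply: IH2 => x y xs ys; apply: mono; exact: sub2.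
  + rewrite !head_map // mono //; [apply: sub1|apply: sub2]; rewrite -nth0; exact: mem_nth.
Qed.

Lemma positive_tree_size_gt0 p s t : positive_tree p s t -> 0 < size s.
Proof. by move/positive_tree_leaves/perm_size <-; exact: size_leaves_gt0. Qed.

Lemma relabel_mark_root f t : relabel f (mark_root t) = mark_root (relabel f t).
Proof. by case: t. Qed.

Lemma positive_tree_relabel f p s t : positive_tree p s t ->
  {in s &, {mono f : x y / x < y}} -> positive_tree p (map f s) (relabel f t).
Proof.
elim=> {p s t} [a|a p s t pt IH|p s t mt|p1 s1 t1 p2 s2 t2 mt1 pt2 IH2] mono /=.
- by constructor.
- constructor; apply: IH => x y xs ys; apply: mono; exact/mem_behead.
- rewrite map_rev relabel_mark_root; constructor; apply: motzkin_tree_relabel mt _.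
  by move=> x y xs ys; apply: mono; rewrite mem_rev.
- have sub1 : {subset s1 <= rev s1 ++ s2} by move=> x xs; rewrite mem_cat mem_rev xs.
  have sub2 : {subset s2 <= rev s1 ++ s2} by move=> x xs; rewrite mem_cat xs orbT.
  have h1 : 0 < size s1 by exact: ltnW (motzkin_tree_size_gt1 mt1).
  have h2 := positive_tree_size_gt0 pt2.
  have -> : joint s1 s2 = joint (map f s1) (map f s2).
    rewrite /joint !head_map // mono //; [apply: sub1|apply: sub2]; rewrite -nth0; exact: mem_nth.
  rewrite map_cat map_rev; constructor.
  + by apply: motzkin_tree_relabel mt1 _ => x y xs ys; apply: mono; exact: sub1.
  + by apply: IH2 => x y xs ys; apply: mono; exact: sub2.
Qed.

(** * Standardization of labels *)

Lemma laminvK I : {in I, cancel (laminv I) (lam I)}.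
Proof. by move=> x xI; rewrite /lam /laminv /= nth_index // mem_sort. Qed.

Lemma laminv_mono I : {in I &, {mono laminv I : x y / x < y}}.
Proof.
move=> x y xI yI; rewrite ltnS; set S := sort leq I.
have srt : sorted leq S by apply: sort_sorted; exact: leq_total.
have mx : x \in S by rewrite mem_sort.
have my : y \in S by rewrite mem_sort.
have le := sorted_leq_index leq_trans leqnn srt.
have lexy := le _ _ mx my; have leyx := le _ _ my mx.
case: (ltngtP x y) => [xy|yx|->]; last by rewrite ltnn.
  by rewrite ltnNge; apply/negP => /leyx; lia.
by apply/negP => /ltnW/lexy; lia.
Qed.

(** Up to permutation [s] is the sorted list, whose entry at index [i] is sent to [i.+1]. *)
Lemma perm_laminv I s : uniq s -> perm_eq I s ->
  perm_eq (map (laminv I) s) (iota 1 (size s)).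
Proof.
move=> us Is; have Ss : perm_eq s (sort leq I) by rewrite perm_sym perm_sort.
have uS : uniq (sort leq I) by rewrite -(perm_uniq Ss).
rewrite (perm_size Ss); apply: perm_trans (perm_map _ Ss) _.
suff -> : map (laminv I) (sort leq I) = iota 1 (size (sort leq I)) by [].
apply: (@eq_from_nth _ 0); rewrite size_map ?size_iota // => i lt_i.
by rewrite (nth_map 0) // nth_iota // /laminv index_uniq.
Qed.

(** Used for a marked root: there [phi'] does not relabel back, so standardizing must change
    nothing. *)
Lemma laminv_id I n : perm_eq I (iota 1 n) -> {in I, laminv I =1 id}.
Proof.
move=> In x; rewrite (perm_mem In) mem_iota add1n => /andP[x0 xn].
have ES : sort leq I = iota 1 n.
  rewrite -[RHS](sorted_sort leq_trans (iota_sorted 1 n)).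
  exact/(perm_sortP leq_total leq_trans anti_leq).
have Ex : x = nth 0 (iota 1 n) x.-1 by rewrite nth_iota; lia.
by rewrite /laminv ES {1}Ex index_uniq ?iota_uniq ?size_iota //; lia.
Qed.

Lemma relabel_id_in f t : {in leaves t, f =1 id} -> relabel f t = t.
Proof.
elim: t => [m l|m a IHa b IHb] /= fid; first by rewrite fid ?mem_head.
rewrite IHa ?IHb // => x xl; apply: fid; rewrite mem_cat xl ?orbT //.
Qed.

Lemma relabel_comp f g t : relabel f (relabel g t) = relabel (f \o g) t.
Proof. by elim: t => //= m a -> b ->. Qed.

Lemma relabel_laminvK I t :
  {subset leaves t <= I} -> relabel (lam I) (relabel (laminv I) t) = t.
Proof.
by move=> sub; rewrite relabel_comp relabel_id_in // => x /sub; exact: laminvK.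
Qed.

(** The round trip of a recursive call: labels are standardized, then restored. [I] is separate from
    [s] because the first call standardizes [s1] with respect to the list [rev s1]. *)
Lemma standardize_motzkin p s t I : motzkin_tree p s t -> uniq s -> perm_eq I s ->
  [/\ motzkin_tree p (map (laminv I) s) (relabel (laminv I) t),
      perm_eq (map (laminv I) s) (iota 1 (size s)) &
      relabel (lam I) (relabel (laminv I) t) = t].
Proof.
move=> mt us Is; split; last 2 first.
- exact: perm_laminv.
- by apply: relabel_laminvK => x; rewrite (perm_mem (motzkin_tree_leaves mt)) (perm_mem Is).
apply: motzkin_tree_relabel mt _ => x y xs ys; apply: laminv_mono; by rewrite (perm_mem Is).
Qed.

Lemma standardize_positive p s t I : positive_tree p s t -> uniq s -> perm_eq I s ->
  [/\ positive_tree p (map (laminv I) s) (relabel (laminv I) t),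
      perm_eq (map (laminv I) s) (iota 1 (size s)) &
      relabel (lam I) (relabel (laminv I) t) = t].
Proof.
move=> pt us Is; split; last 2 first.
- exact: perm_laminv.
- by apply: relabel_laminvK => x; rewrite (perm_mem (positive_tree_leaves pt)) (perm_mem Is).
apply: positive_tree_relabel pt _ => x y xs ys; apply: laminv_mono; by rewrite (perm_mem Is).
Qed.

(** * Evaluation of the recursive functions *)

(** The last step of [p] goes from 0 to -1, so the reversed word starts with an up step and both
    functions enter their up-step clause. *)
Lemma head_negrev_motzkin p : motzkin_word p -> exists q, negrev p = 1%R :: q.
Proof.
move=> mp; have p0 := motzkin_word_size mp; have lastp := motzkin_word_last mp.
have [_ _ tot] := mp.
have := size_negrev p; have := psum_negrev p0; rewrite subn1 lastp tot.
case: (negrev p) => [|x q] /=; first by move=> _ E; rewrite -E in p0.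
by rewrite psum_cons psum0 addr0 => -> _; exists q.
Qed.

(** The cut at [k = size p + 1] takes [k] labels but [k - 1] steps; the step [a] in between belongs
    to neither word. *)
Lemma take_node p a q (s1 s2 : seq nat) : size s1 = (size p).+1 ->
  [/\ take (size p).+1 (rev s1 ++ s2) = rev s1, drop (size p).+1 (rev s1 ++ s2) = s2,
      rev [seq (- x)%R | x <- take (size p) (negrev p ++ a :: q)] = p &
      drop (size p).+1 (negrev p ++ a :: q) = q].
Proof.
move=> sz; have szr : size (rev s1) = (size p).+1 by rewrite size_rev.
split; [exact: take_size_cat|exact: drop_size_cat| |].
  by rewrite take_size_cat ?size_negrev // -/(negrev _) negrevK.
by rewrite -cat_rcons drop_size_cat // size_rcons size_negrev.
Qed.

(** One unfolding that leaves [p] itself in place, so that the cut lemmas about [negrev p1 ++ _]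
    still rewrite. *)
Lemma phi_up fuel p q s (k := first_zero p) : p = 1%R :: q -> 2 < size s ->
  phi fuel.+1 p s =
  BNode false
    (relabel (lam (take k s))
       (phi fuel (rev [seq (- x)%R | x <- take k.-1 p])
                 (map (laminv (take k s)) (rev (take k s)))))
    (relabel (lam (drop k s)) (phi fuel (drop k p) (map (laminv (drop k s)) (drop k s)))).
Proof. by rewrite {}/k => -> big; rewrite [LHS]/= leqNgt big. Qed.

Lemma phi'_up fuel p q s (k := last_one (size s) p) : p = 1%R :: q -> 1 < size s ->
  phi' fuel.+1 p s =
  let t1 := Phi (rev [seq (- x)%R | x <- take k.-1 p])
                (map (laminv (take k s)) (rev (take k s))) in
  if k == size s then mark_root t1
  else BNode false (relabel (lam (take k s)) t1)
    (relabel (lam (drop k s)) (phi' fuel (drop k p) (map (laminv (drop k s)) (drop k s)))).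
Proof. by rewrite {}/k => -> big; rewrite [LHS]/= leqNgt big. Qed.

(** Induction on the fuel, each call receiving fewer labels. The labels must fill an initial segment
    because [phi] gives the cherry the fixed labels 1 and 2. *)
Lemma motzkin_tree_phi p s t fuel : motzkin_tree p s t ->
  perm_eq s (iota 1 (size s)) -> size s <= fuel -> phi fuel p s = t.
Proof.
elim: fuel p s t => [|fuel IH] p s t mt; first by have := motzkin_tree_size_gt1 mt; lia.
case: mt => {p s t} [a b ab|a p s t mt|p1 s1 t1 p2 s2 t2 mt1 mt2 lt12] st le_s.
- have := perm_mem st a; have := perm_mem st b; rewrite !inE !eqxx !orbT /=.
  move=> /esym hb /esym ha.
  by have [-> ->] : a = 1 /\ b = 2 by lia.
- have /= /andP[_ us] : uniq (a :: s) by rewrite (perm_uniq st) iota_uniq.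
  have big := motzkin_tree_size_gt1 mt.
  have [mt' st' tK] := standardize_motzkin mt us (perm_refl s).
  by rewrite /= ltnNge big /= (IH _ _ _ mt') ?size_map // tK.
have [us1 us2] : uniq s1 /\ uniq s2.
  have : uniq (rev s1 ++ s2) by rewrite (perm_uniq st) iota_uniq.
  by rewrite cat_uniq rev_uniq => /and3P[].
have [mt1' st1' tK1] := standardize_motzkin mt1 us1 (permEl (perm_rev s1)).
have [mt2' st2' tK2] := standardize_motzkin mt2 us2 (perm_refl s2).
have big1 := motzkin_tree_size_gt1 mt1; have big2 := motzkin_tree_size_gt1 mt2.
have mw1 := motzkin_tree_word mt1.
have Efz := first_zero_node p2 mw1.
have [T1 T2 T3 T4] := take_node (-1)%R p2 s2 (motzkin_tree_size mt1).
rewrite size_cat size_rev in le_s.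
have [q Eq] := head_negrev_motzkin mw1.
have Ew : negrev p1 ++ (-1)%R :: p2 = 1%R :: (q ++ (-1)%R :: p2) by rewrite Eq.
rewrite (phi_up _ Ew) ?size_cat ?size_rev; last by lia.
rewrite Efz T1 T2 revK T3 T4.
by rewrite (IH _ _ _ mt1') ?(IH _ _ _ mt2') ?size_map ?tK1 ?tK2 //; lia.
Qed.

Lemma positive_tree_phi' p s t fuel : positive_tree p s t ->
  perm_eq s (iota 1 (size s)) -> size s <= fuel -> phi' fuel p s = t.
Proof.
elim: fuel p s t => [|fuel IH] p s t pt; first by have := positive_tree_size_gt0 pt; lia.
case: pt => {p s t} [a|a p s t pt|p s t mt|p1 s1 t1 p2 s2 t2 mt1 pt2] st le_s.
- by [].
- have /= /andP[_ us] : uniq (a :: s) by rewrite (perm_uniq st) iota_uniq.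
  have big := positive_tree_size_gt0 pt.
  have [pt' st' tK] := standardize_positive pt us (perm_refl s).
  by rewrite /= ltnNge big /= (IH _ _ _ pt') ?size_map // tK.
- have mw := motzkin_tree_word mt; have big := motzkin_tree_size_gt1 mt.
  have Elo := last_one_negrev mw; rewrite -(motzkin_tree_size mt) in Elo.
  have us : uniq s by rewrite -rev_uniq (perm_uniq st) iota_uniq.
  have [mt' st' _] := standardize_motzkin mt us (permEl (perm_rev s)).
  have [q Eq] := head_negrev_motzkin mw.
  have Ep : rev [seq (- x)%R | x <- take (size s).-1 (negrev p)] = p.
    rewrite take_oversize; last by rewrite size_negrev (motzkin_tree_size mt).
    exact: negrevK.
  rewrite (phi'_up _ Eq) ?size_rev // Elo eqxx.
  rewrite [take _ (rev s)]take_oversize ?size_rev // revK Ep /Phi.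
  rewrite (motzkin_tree_phi mt') ?size_map // relabel_id_in // => x.
  rewrite (perm_mem (motzkin_tree_leaves mt)) -mem_rev; exact: (laminv_id st).
have [us1 us2] : uniq s1 /\ uniq s2.
  have : uniq (rev s1 ++ s2) by rewrite (perm_uniq st) iota_uniq.
  by rewrite cat_uniq rev_uniq => /and3P[].
have [mt1' st1' tK1] := standardize_motzkin mt1 us1 (permEl (perm_rev s1)).
have [pt2' st2' tK2] := standardize_positive pt2 us2 (perm_refl s2).
have big1 := motzkin_tree_size_gt1 mt1; have big2 := positive_tree_size_gt0 pt2.
have mw1 := motzkin_tree_word mt1; have pw2 := positive_tree_word pt2.
have sz1 := motzkin_tree_size mt1.
have [sz2 _] := positive_tree_compatible pt2 us2.
have szs : size (rev s1 ++ s2) = (size (negrev p1 ++ joint s1 s2 :: p2)).+1.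
  by rewrite !size_cat size_rev size_negrev /= sz1 sz2; lia.
have Elo := last_one_node mw1 pw2 (joint_unit s1 s2) szs.
have [T1 T2 T3 T4] := take_node (joint s1 s2) p2 s2 (motzkin_tree_size mt1).
have [q Eq] := head_negrev_motzkin mw1.
have Ew : negrev p1 ++ joint s1 s2 :: p2 = 1%R :: (q ++ joint s1 s2 :: p2) by rewrite Eq.
(* The second subpath carries at least one label, so the test for a marked root fails. *)
have nsz : ((size p1).+1 == size (rev s1 ++ s2)) = false.
  by apply/negbTE; rewrite size_cat size_rev sz1; lia.
have big : 1 < size (rev s1 ++ s2) by rewrite size_cat size_rev; lia.
rewrite size_cat size_rev in le_s.
rewrite (phi'_up _ Ew big) Elo nsz T1 T2 revK T3 T4.
by rewrite /Phi (motzkin_tree_phi mt1') ?(IH _ _ _ pt2') ?size_map ?tK1 ?tK2 //; lia.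
Qed.

(** The path has some tree by existence, and evaluation identifies it with the computed one. *)
Lemma positive_path_tree n p s : 0 < n -> positive_path n p s ->
  positive_tree p s (Phi' p s).
Proof.
move=> n0 [[szp szs perm st lab] pos].
have cp : compatible p s by split; [lia | rewrite szp].
have pw : positive_word p.
  split=> // -[|j] le_j; first by rewrite psum0.
  by apply: pos; lia.
have [t pt] := positive_tree_exists pw cp.
by rewrite /Phi' (positive_tree_phi' pt) // szs.
Qed.

Theorem theorem2 (n : nat) : 0 < n ->
  [/\ (forall p s, positive_path n p s -> marked_ltree n (Phi' p s)),
      (forall p1 s1 p2 s2, positive_path n p1 s1 -> positive_path n p2 s2 ->
         tree_iso (Phi' p1 s1) (Phi' p2 s2) -> p1 = p2 /\ s1 = s2) &
      (forall t, marked_ltree n t ->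
         exists p s, positive_path n p s /\ tree_iso (Phi' p s) t)].
Proof.
move=> n0; split.
- move=> p s pp; have pt := positive_path_tree n0 pp.
  split; last exact: positive_tree_nmarks pt.
  by apply: perm_trans (positive_tree_leaves pt) _; case: pp => -[].
- move=> p1 s1 p2 s2 /(positive_path_tree n0) pt1 /(positive_path_tree n0) pt2.
  exact: positive_tree_inj.
- move=> t [perm marks].
  have un : uniq (leaves t) by rewrite (perm_uniq perm) iota_uniq.
  have [p [s [t' [pt it]]]] := positive_tree_surj un marks.
  (* The labels of the path are the leaves of [t'], which are those of [t]. *)
  have perms : perm_eq s (iota 1 n).
    rewrite -(permPl (positive_tree_leaves pt)).
    exact: perm_trans (tree_iso_leaves it) perm.
  have szs : size s = n by rewrite (perm_size perms) size_iota.
  have us : uniq s by rewrite (perm_uniq perms) iota_uniq.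
  have [sz ok] := positive_tree_compatible pt us.
  have [st pos] := positive_tree_word pt.
  have szp : size p = n.-1 by lia.
  (* [Phi' p s] evaluates to [t'] itself, so [it] is the required isomorphism. *)
  exists p, s; split; last by rewrite /Phi' (positive_tree_phi' pt) // szs.
  split; last by move=> j /andP[_ le_j]; apply: pos; rewrite szp.
  by split=> // i lt_i; apply: ok; rewrite szp.
Qed.
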